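(* Let $d\ge 1$, fix a state $s$, and let $\pi_\beta(\cdot|s)$ be a probability density on $\mathbb{R}^d$ that vanishes outside a compact set and satisfies $\pi_\beta(\cdot|s)\in C^3(\mathbb{R}^d,\mathbb{R})$. For $t\in(0,1)$ let $p_t(\cdot|s)$ be the density of $a_t = t a_0 + (1-t)\eta$, where $a_0\sim\pi_\beta(\cdot|s)$ and $\eta\sim\mathcal{N}(0,I_d)$ are independent, and let $p_1(\cdot|s)=\pi_\beta(\cdot|s)$. Let $\mathbf{s}_t(a|s)=\nabla_a\log p_t(a|s)$ be the associated score function at time $t$. Then for every point $a\in\mathbb{R}^d$ with $\pi_\beta(a|s)>0$, as $\varepsilon\to 0^+$, $$\|\mathbf{s}_{1-\varepsilon}(a|s)-\mathbf{s}_1(a|s)\| = \varepsilon\,\left\|\nabla_a\big(a^\top\nabla_a\log\pi_\beta(a|s)\big)\right\| + \mathcal{O}(\varepsilon^2).$$ Consequently $\|\mathbf{s}_{1-\varepsilon}(a|s)-\mathbf{s}_1(a|s)\|=\mathcal{O}(\varepsilon)$ as $\varepsilon\to0^+$, i.e. the approximation of $\mathbf{s}_1$ by $\mathbf{s}_{1-\varepsilon}$ has a first-order convergence rate.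
   Context: The action space is $\mathbb{R}^d$ with the Euclidean norm $\|\cdot\|$; the state $s$ is a fixed parameter. The behavioral policy $\pi_\beta(\cdot|s)$ is a probability density in the action variable $a$. The path $a_t=ta_0+(1-t)\eta$ is the linear Gaussian interpolation path, which is standard Gaussian at $t=0$ and distributed as $\pi_\beta(\cdot|s)$ at $t=1$. Explicitly, for $t\in(0,1)$, $p_t(a|s)=\int_{\mathbb{R}^d}\pi_\beta(a_0|s)\,\mathcal{N}\big(a;ta_0,(1-t)^2I_d\big)\,da_0$, where $\mathcal{N}(a;m,\Sigma)$ denotes the Gaussian density with mean $m$ and covariance $\Sigma$ evaluated at $a$. Convergence is pointwise: the constant in $\mathcal{O}(\cdot)$ may depend on $a$, $s$, $d$ and $\pi_\beta$. *)

(* Defs.v *)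
From HB Require Import structures.
From mathcomp Require Import all_boot all_order all_algebra.
From mathcomp Require Import all_classical all_reals all_analysis.

Set Implicit Arguments.
Unset Strict Implicit.
Unset Printing Implicit Defensive.
Import Order.TTheory GRing.Theory Num.Theory.
Import numFieldNormedType.Exports.

Local Open Scope classical_set_scope.
Local Open Scope ring_scope.

(* Lebesgue measure on R^n, carried by n.-tuple R (whose library sigma-algebra
   is the product of the Borel sigma-algebras): the point mass for n = 0, and
   the image of lambda \x lambda^n under (x, u) |-> x :: u for n.+1. *)
Section lebesgue_measure_tuple.
Context {R : realType}.
Local Notation mR := (measurableTypeR R).

Definition cons_pair n (p : mR * n.-tuple mR) : n.+1.-tuple mR :=
  [tuple of p.1 :: p.2].

Lemma measurable_cons_pair n :
  measurable_fun [set: mR * n.-tuple mR] (@cons_pair n).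
Proof. by apply: measurable_cons. Qed.

Section cons.
Variables (n : nat) (mu : {sigma_finite_measure set (n.-tuple mR) -> \bar R}).

Definition lebesgue_cons : set (n.+1.-tuple mR) -> \bar R :=
  pushforward (lebesgue_measure \x mu)%E (@cons_pair n).

Let mcons := @measurable_cons_pair n.

Let lebesgue_cons0 : lebesgue_cons set0 = 0%E.
Proof. exact: measure0. Qed.

Let lebesgue_cons_ge0 A : (0 <= lebesgue_cons A)%E.
Proof. exact: measure_ge0. Qed.

Let lebesgue_cons_sigma_additive : semi_sigma_additive lebesgue_cons.
Proof. exact: measure_semi_sigma_additive. Qed.

HB.instance Definition _ := isMeasure.Build _ _ _ lebesgue_cons
  lebesgue_cons0 lebesgue_cons_ge0 lebesgue_cons_sigma_additive.

Let lebesgue_cons_sigma_finite : sigma_finite setT lebesgue_cons.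
Proof.
have /sigma_finiteP[F [FT ndF Foo]] := sigma_finiteT (@lebesgue_measure R).
have /sigma_finiteP[G [GT ndG Goo]] := sigma_finiteT mu.
pose g (u : n.+1.-tuple mR) : mR * n.-tuple mR :=
  (tnth u ord0, [tuple of behead u]).
have mg : measurable_fun setT g.
  apply/measurable_fun_pair; first exact: measurable_tnth.
  exact: measurable_behead.
have gK p : g (cons_pair p) = p by case: p => x u; congr pair; apply/val_inj.
exists (fun k => g @^-1` (F k `*` G k)).
  apply/esym; rewrite -subTset => u _.
  have [i _ Fi] : (\bigcup_k F k) (g u).1 by rewrite -FT.
  have [j _ Gj] : (\bigcup_k G k) (g u).2 by rewrite -GT.
  exists (maxn i j) => //; split.
    by move: Fi; exact/subsetPset/ndF/leq_maxl.
  by move: Gj; exact/subsetPset/ndG/leq_maxr.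
move=> k; have [mF Fk] := Foo k; have [mG Gk] := Goo k; split.
  by rewrite -[X in measurable X]setTI; apply: mg => //; exact: measurableX.
rewrite /lebesgue_cons /pushforward -comp_preimage.
rewrite (_ : g \o _ = id) ?preimage_id; last exact/funext.
by rewrite product_measure1E// lte_mul_pinfty// ge0_fin_numE.
Qed.

HB.instance Definition _ := Measure_isSigmaFinite.Build _ _ _ lebesgue_cons
  lebesgue_cons_sigma_finite.

End cons.

Fixpoint lebesgue_measure_tuple n :
    {sigma_finite_measure set (n.-tuple mR) -> \bar R} :=
  match n with
  | 0 => dirac [tuple]
  | m.+1 => lebesgue_cons (lebesgue_measure_tuple m)
  end.

Lemma lebesgue_measure_tuple_box n (A : 'I_n -> set mR) :
  (forall i, measurable (A i)) ->
  lebesgue_measure_tuple n [set u | forall i, A i (tnth u i)] =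
    (\prod_(i < n) lebesgue_measure (A i))%E.
Proof.
elim: n A => [|n IH] A mA /=.
  by rewrite big_ord0 diracE mem_set//= => -[].
rewrite big_ord_recl -IH//= /lebesgue_cons /pushforward.
rewrite -product_measure1E//.
  congr (_ _); apply/seteqP; split=> [[x u] /= Au|[x u] /= [A0 Au] i].
    split=> [|i]; first exact: (Au ord0).
    by have := Au (lift ord0 i); rewrite tnthS.
  by case: (unliftP ord0 i) => [j ->|->//]; rewrite tnthS.
rewrite (_ : [set _ | _] = \bigcap_(i in [set` enum 'I_n])
    ((fun u => tnth u i) @^-1` A (lift ord0 i))); last first.
  apply/seteqP; split=> u /= Au i; first by move=> _; exact: Au.
  by apply: Au; rewrite /= mem_enum.
rewrite bigcap_seq; apply: bigsetI_measurable => i _.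
by rewrite -[X in measurable X]setTI; exact: measurable_tnth.
Qed.

End lebesgue_measure_tuple.

Section euclidean.
Context {R : realType} {d : nat}.
Implicit Types (a m u v : 'rV[R]_d) (f q : 'rV[R]_d -> R).

Definition row_of_tuple (u : d.-tuple (measurableTypeR R)) : 'rV[R]_d :=
  \row_i tnth u i.

Definition dotmul u v : R := (u *m v^T) ord0 ord0.

(* The library norm on 'rV[R]_d is the sup norm, hence this one. *)
Definition enorm v : R := Num.sqrt (dotmul v v).

Definition partial (i : 'I_d) f : 'rV[R]_d -> R := 'D_(delta_mx ord0 i) f.

Definition gradient f a : 'rV[R]_d := \row_i partial i f a.

(* All partial derivatives of order at most k exist and are continuous. *)
Fixpoint Ck (k : nat) f : Prop :=
  match k with
  | 0 => continuous f
  | k'.+1 => continuous f /\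
      forall i : 'I_d, (forall a, derivable f a (delta_mx ord0 i)) /\
                       Ck k' (partial i f)
  end.

Definition probability_density f : Prop :=
  [/\ measurable_fun [set: d.-tuple (measurableTypeR R)] (f \o row_of_tuple),
      forall a, 0 <= f a &
      (\int[lebesgue_measure_tuple d]_u (f (row_of_tuple u))%:E = 1)%E].

Definition gaussian_density m (Sigma : 'M[R]_d) a : R :=
  (Num.sqrt ((2 * pi) ^+ d * \det Sigma))^-1 *
  expR (- (dotmul ((a - m) *m invmx Sigma) (a - m)) / 2).

(* Density of t *: a0 + (1 - t) *: eta for independent a0 ~ q and standard
   Gaussian eta; at t = 1, where the Gaussian kernel degenerates, it is q.
   Only t in ]0, 1] is meaningful. *)
Definition path_density q (t : R) a : R :=
  if t == 1 then q a
  else \int[lebesgue_measure_tuple d]_u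
         (q (row_of_tuple u) *
          gaussian_density (t *: row_of_tuple u) (((1 - t) ^+ 2)%:M) a).

Definition score q (t : R) a : 'rV[R]_d :=
  gradient (fun x => ln (path_density q t x)) a.

End euclidean.

(* Main.v *)
Require Import Defs.
From mathcomp Require Import all_boot all_order all_algebra.
From mathcomp Require Import all_classical all_reals all_analysis.
From mathcomp Require Import measurable_realfun ring lra.

Import Order.TTheory GRing.Theory Num.Theory.
Import numFieldNormedType.Exports.

Local Open Scope classical_set_scope.
Local Open Scope ring_scope.

(* With c = 1 / (1 - eps) and s = eps / (1 - eps) = c - 1, the substitution
   u = c x + s z turns p_(1 - eps) (x) into a constant times
   P x = \int q (c x + s z) w z dz, where w z = exp (- |z|^2 / 2) no longer
   depends on eps; the constant is invisible to the gradient of the logarithm,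
   and the i-th partial of P is c \int ('d_i q) (c x + s z) w z dz.  At x = a one
   has c a + s z = a + s (a + z), so for f = q and f = 'd_i q the quadratic Taylor
   bound, global because q is C^3 with compact support, and the vanishing of the
   first moments of w give
     \int f (c a + s z) w z dz = (f a + s \sum_k a_k 'd_k f a) \int w + O(s^2).
   Dividing the two expansions, and exchanging the mixed partials, the score at
   1 - eps is the score at 1 plus s times the gradient of x . grad (ln q) at a,
   up to O(s^2); finally s = eps + O(eps^2). *)

(** * Integration over tuples: Tonelli, coordinatewise substitution, products *)

Section integral_tuple.
Set Implicit Arguments.
Unset Strict Implicit.
Context {R : realType}.
Local Notation mR := (measurableTypeR R).
Local Notation lambda := (@lebesgue_measure R).
Local Open Scope ereal_scope.

Lemma ge0_integral_lebesgue_tupleS n (F : n.+1.-tuple mR -> \bar R) :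
  measurable_fun [set: n.+1.-tuple mR] F -> (forall u, 0 <= F u) ->
  \int[lebesgue_measure_tuple n.+1]_u F u =
  \int[lambda]_x \int[lebesgue_measure_tuple n]_u F (cons_pair (x, u)).
Proof.
move=> mF F0; have mc := @measurable_cons_pair R n.
rewrite [LHS](ge0_integral_pushforward mc) //.
rewrite preimage_setT fubini_tonelli1//; first exact: measurableT_comp.
by move=> p; exact: F0.
Qed.

Lemma measurable_tuple_comp n (phi : 'I_n -> mR -> mR) :
  (forall i, measurable_fun setT (phi i)) ->
  measurable_fun [set: n.-tuple mR]
    (fun u : n.-tuple mR => [tuple phi i (tnth u i) | i < n] : n.-tuple mR).
Proof.
move=> mphi; apply/measurable_fun_tnthP => i.
rewrite (_ : _ \o _ = phi i \o (fun u : n.-tuple mR => tnth u i)); last first.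
  by apply/funext => u /=; rewrite tnth_mktuple.
by apply: measurableT_comp => //; exact: measurable_tnth.
Qed.

(** Tonelli peels off the first coordinate and each coordinate contributes one factor [k]. The
    one-dimensional rule is kept as a hypothesis so that the result serves both affine maps, with
    [k] the inverse slope, and the reflection, with [k] equal to 1. *)
Lemma ge0_integral_tuple_comp n (phi : 'I_n -> mR -> mR) (k : R)
    (F : n.-tuple mR -> \bar R) :
  (0 <= k)%R -> (forall i, measurable_fun setT (phi i)) ->
  (forall i (f : mR -> \bar R), measurable_fun setT f -> (forall x, 0 <= f x) ->
    \int[lambda]_x f (phi i x) = k%:E * \int[lambda]_x f x) ->
  measurable_fun [set: n.-tuple mR] F -> (forall u, 0 <= F u) ->
  \int[lebesgue_measure_tuple n]_u F [tuple phi i (tnth u i) | i < n] =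
  (k ^+ n)%:E * \int[lebesgue_measure_tuple n]_u F u.
Proof.
move=> k0; elim: n => [|n IH] in phi F *.
  move=> _ _ mF F0; rewrite expr0 mul1e; apply: eq_integral => u _.
  by congr (F _); apply: eq_from_tnth => -[].
move=> mphi phiE mF F0.
have mt := measurable_tuple_comp mphi.
rewrite !ge0_integral_lebesgue_tupleS//; last first.
  by apply: (measurableT_comp mF).
have mFc : measurable_fun [set: mR * n.-tuple mR] (F \o @cons_pair R n).
  by apply: measurableT_comp => //; exact: measurable_cons_pair.
pose G (x : mR) := \int[lebesgue_measure_tuple n]_u F (cons_pair (x, u)).
have G0 x : 0 <= G x by exact: integral_ge0.
have mG : measurable_fun setT G.
  by apply: (@measurable_fun_fubini_tonelli_F _ _ _ _ _ (lebesgue_measure_tuple n)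
     (F \o @cons_pair R n)) => // p; exact: F0.
transitivity (\int[lambda]_x ((k ^+ n)%:E * G (phi ord0 x))).
  apply: eq_integral => x _.
  (* For a fixed first coordinate, the induction hypothesis substitutes in all the others. *)
  rewrite /G -(IH (fun i => phi (lift ord0 i)))//; last 2 first.
  - by move=> i f; exact: phiE.
  - apply: measurableT_comp => //; apply: measurableT_comp => //.
    exact: measurable_cons_pair.
  apply: eq_integral => u _; congr F; apply: eq_from_tnth => i.
  rewrite tnth_mktuple; case: (unliftP ord0 i) => [j ->|->] //.
  by rewrite !tnthS/= tnth_mktuple.
have mGphi : measurable_fun [set: mR] (fun x => G (phi ord0 x)).
  exact: (measurableT_comp mG).
rewrite (@ge0_integralZl _ _ _ lambda _ measurableT _ mGphi); last 2 first.
- by move=> x _; exact: G0.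
- by rewrite lee_fin exprn_ge0.
by rewrite phiE// exprSr EFinM muleA.
Qed.

Lemma ge0_integral_tuple_prod n (h : mR -> R) :
  measurable_fun setT h -> (forall x, (0 <= h x)%R) ->
  \int[lebesgue_measure_tuple n]_u (\prod_(i < n) h (tnth u i))%:E =
  (\int[lambda]_x (h x)%:E) ^+ n.
Proof.
move=> mh h0; elim: n => [|n IH].
  under eq_integral do rewrite big_ord0.
  by rewrite integral_cst//= mul1e diracE mem_set.
have mp m : measurable_fun [set: m.-tuple mR]
    (fun u : m.-tuple mR => (\prod_(i < m) h (tnth u i))%:E).
  apply/measurable_EFinP; apply: measurable_prod => i _.
  by apply: measurableT_comp => //; exact: measurable_tnth.
have p0 m (u : m.-tuple mR) : (0 <= \prod_(i < m) h (tnth u i))%R.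
  exact: prodr_ge0.
rewrite ge0_integral_lebesgue_tupleS//; last by move=> u; rewrite lee_fin.
transitivity (\int[lambda]_x ((h x)%:E * (\int[lambda]_y (h y)%:E) ^+ n)).
  apply: eq_integral => x _; rewrite -IH -ge0_integralZl//; last 3 first.
  - exact: mp.
  - by move=> u _; rewrite lee_fin.
  - by rewrite lee_fin.
  apply: eq_integral => u _; rewrite big_ord_recl EFinM; congr (_%:E * _%:E).
  by apply: eq_bigr => i _; rewrite tnthS.
rewrite ge0_integralZr//; last 3 first.
- exact/measurable_EFinP.
- by move=> x _; rewrite lee_fin.
- by apply: expe_ge0; apply: integral_ge0 => x _; rewrite lee_fin.
by rewrite expeS.
Qed.

End integral_tuple.

(** * Affine changes of variable and reflection on the line *)

Section integral_affine.
Set Implicit Arguments.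
Unset Strict Implicit.
Context {R : realType}.
Local Notation mR := (measurableTypeR R).
Local Notation lambda := (@lebesgue_measure R).
Local Open Scope ereal_scope.

Lemma measurable_affine (s b : R) :
  measurable_fun [set: mR] (fun x : mR => (s * x + b)%R : mR).
Proof. by apply: measurable_funD => //; exact: measurable_funM. Qed.

(** The image of Lebesgue measure under the affine map, multiplied by [s], gives every half-open
    interval its length, so by uniqueness it is Lebesgue measure. *)
Lemma ge0_integral_affine (s b : R) (f : mR -> \bar R) : (0 < s)%R ->
  measurable_fun [set: mR] f -> (forall x, 0 <= f x) ->
  \int[lambda]_x f (s * x + b)%R = (s^-1)%:E * \int[lambda]_x f x.
Proof.
move=> s0 mf f0.
pose phi (x : mR) : mR := (s * x + b)%R.
have mphi : measurable_fun [set: mR] phi := measurable_affine s b.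
pose nu := mscale (NngNum (ltW s0)) (pushforward lambda phi).
have -> : \int[lambda]_x f x = \int[nu mphi]_x f x.
  apply: eq_measure_integral => A mA _.
  apply: lebesgue_measure_unique => // _ [[x y]] _ <-.
  rewrite -[RHS]/(s%:E * lambda (phi @^-1` `]x, y]%classic)).
  rewrite (_ : _ @^-1` _ = `](x - b) / s, (y - b) / s]%classic)%R; last first.
    apply/seteqP; split => z /=; rewrite !in_itv/= ltr_pdivrMr// ler_pdivlMr//;
      by rewrite mulrC ltrBlDr lerBrDr.
  rewrite !lebesgue_measure_itv/= !lte_fin ltr_pM2r ?invr_gt0// ltrD2r.
  case: ifPn => _; last by rewrite mule0.
  by rewrite -!EFinD -EFinM; congr EFin; field; rewrite gt_eqF.
rewrite ge0_integral_mscale//= ge0_integral_pushforward//.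
by rewrite preimage_setT muleA -EFinM mulVf ?gt_eqF// mul1e.
Qed.

Lemma ge0_integral_opp (f : mR -> \bar R) :
  measurable_fun [set: mR] f -> (forall x, 0 <= f x) ->
  \int[lambda]_x f (- x)%R = \int[lambda]_x f x.
Proof.
move=> mf f0.
have -> : \int[lambda]_x f x =
    \int[pushforward lambda (-%R : mR -> mR)]_x f x.
  by apply: eq_measure_integral => A mA _; rewrite -[LHS]lebesgue_measureN.
by rewrite ge0_integral_pushforward.
Qed.

End integral_affine.

(** * The Gaussian weight: total mass, domination, parity *)

Section gauss.
Set Implicit Arguments.
Unset Strict Implicit.
Context {R : realType} {n : nat}.
Local Notation mR := (measurableTypeR R).
Local Notation lambda := (@lebesgue_measure R).
Local Notation mu := (@lebesgue_measure_tuple R n).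
Local Notation T := (n.-tuple mR).

Definition sqnorm (z : T) : R := \sum_(i < n) tnth z i ^+ 2.

(** Left unnormalised: [c] is 1/2 for the weight of the standard Gaussian and 1/4 for the weight
    that dominates it times polynomials. *)
Definition gauss (c : R) (z : T) : R := expR (- (c * sqnorm z)).

Lemma sqnorm_ge0 z : 0 <= sqnorm z.
Proof. by apply: sumr_ge0 => i _; exact: sqr_ge0. Qed.

Lemma measurable_tnth_fun i : measurable_fun [set: T] (fun z : T => tnth z i : R).
Proof. exact: measurable_tnth. Qed.

Lemma measurable_sqnorm : measurable_fun [set: T] sqnorm.
Proof.
apply: measurable_sum => i; apply: measurable_funX; exact: measurable_tnth_fun.
Qed.

Lemma measurable_gauss c : measurable_fun [set: T] (gauss c).
Proof.
apply: measurableT_comp => //; apply: measurableT_comp => //.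
by apply: measurable_funM => //; exact: measurable_sqnorm.
Qed.

Lemma integral_gauss1 (c : R) : 0 < c ->
  (\int[lambda]_x (expR (- (c * x ^+ 2)))%:E = (Num.sqrt (pi / c))%:E)%E.
Proof.
move=> c0; have sc0 : 0 < Num.sqrt c by rewrite sqrtr_gt0.
transitivity (\int[lambda]_x (gauss_fun (Num.sqrt c * x + 0))%:E)%E.
  apply: eq_integral => x _; rewrite /gauss_fun addr0 exprMn sqr_sqrtr// ltW//.
rewrite (@ge0_integral_affine _ (Num.sqrt c) 0 (fun x : mR => (gauss_fun x)%:E))//.
- by rewrite integralT_gauss -EFinM mulrC sqrtrM ?pi_ge0// sqrtrV// ltW.
- by apply/measurable_EFinP; exact: measurable_gauss_fun.
- by move=> x; rewrite lee_fin gauss_fun_ge0.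
Qed.

Lemma integral_gauss (c : R) : 0 < c ->
  (\int[mu]_z (gauss c z)%:E = (Num.sqrt (pi / c) ^+ n)%:E)%E.
Proof.
move=> c0; rewrite EFin_expe -integral_gauss1//.
rewrite -(@ge0_integral_tuple_prod _ n (fun x : mR => expR (- (c * x ^+ 2))))//.
- apply: eq_integral => z _; congr _%:E; rewrite /gauss /sqnorm mulr_sumr -sumrN.
  by rewrite expR_sum.
- apply: measurableT_comp => //; apply: measurableT_comp => //.
  by apply: measurable_funM => //; exact: measurable_funX.
Qed.

Lemma integrable_gauss (c : R) : 0 < c ->
  mu.-integrable setT (EFin \o gauss c).
Proof.
move=> c0; apply/integrableP; split.
  by apply/measurable_EFinP; exact: measurable_gauss.
under eq_integral => z _ do rewrite /= ger0_norm ?expR_ge0//.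
by rewrite integral_gauss// ltry.
Qed.

Lemma Rintegral_gauss_gt0 (c : R) : 0 < c -> 0 < \int[mu]_z gauss c z.
Proof.
move=> c0; rewrite /Rintegral integral_gauss//= exprn_gt0// sqrtr_gt0.
by rewrite divr_gt0// pi_gt0.
Qed.

Lemma gauss_split z : gauss 2^-1 z = (expR (sqnorm z / 4))^-1 * gauss 4^-1 z.
Proof.
by rewrite /gauss -expRN -expRD; congr expR; field.
Qed.

(* The factor exp (|z|^2 / 4) absorbs polynomial growth, at the price of
   replacing the weight exp (- |z|^2 / 2) by exp (- |z|^2 / 4). *)
Lemma gauss_dominated (F : T -> R) (K : R) : measurable_fun [set: T] F ->
  (forall z, `|F z| <= K * expR (sqnorm z / 4)) ->
  mu.-integrable setT (EFin \o (fun z => F z * gauss 2^-1 z)) /\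
  `|\int[mu]_z (F z * gauss 2^-1 z)| <= K * \int[mu]_z gauss 4^-1 z.
Proof.
move=> mF FK.
have mFw : measurable_fun [set: T] (fun z => F z * gauss 2^-1 z).
  by apply: measurable_funM => //; exact: measurable_gauss.
have Fw z : `|F z * gauss 2^-1 z| <= K * gauss 4^-1 z.
  rewrite normrM [X in _ * X]ger0_norm ?expR_ge0// gauss_split mulrA.
  by rewrite ler_wpM2r ?expR_ge0// ler_pdivrMr ?expR_gt0.
have q4 : 0 < 4^-1 :> R by rewrite invr_gt0.
have iK : mu.-integrable setT (EFin \o (fun z => K * gauss 4^-1 z)).
  rewrite (_ : _ \o _ = fun z => (K%:E * (gauss 4^-1 z)%:E)%E)//.
  by apply: integrableZl => //; exact: integrable_gauss.
have iF : mu.-integrable setT (EFin \o (fun z => F z * gauss 2^-1 z)).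
  apply: le_integrable iK => //=; first exact/measurable_EFinP.
  by move=> z _; rewrite lee_fin (le_trans (Fw z))// ler_norm.
split=> //; apply: le_trans (le_normr_Rintegral _ iF) _ => //.
rewrite -RintegralZl//; last exact: integrable_gauss.
apply: le_Rintegral => //.
exact: (integrable_norm iF).
Qed.

Definition tuple_opp (z : T) : T := [tuple - tnth z i | i < n].

Lemma ge0_integral_tuple_opp (F : T -> \bar R) :
  measurable_fun [set: T] F -> (forall z, 0 <= F z)%E ->
  (\int[mu]_z F (tuple_opp z) = \int[mu]_z F z)%E.
Proof.
move=> mF F0.
rewrite (@ge0_integral_tuple_comp _ n (fun _ => -%R : mR -> mR) 1)//.
- by rewrite expr1n mul1e.
- by move=> i f mf f0; rewrite mul1e ge0_integral_opp.
Qed.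

(** The reflection exchanges the positive and negative parts of [F], so these have equal
    integrals. *)
Lemma Rintegral_odd (F : T -> R) : measurable_fun [set: T] F ->
  (forall z, F (tuple_opp z) = - F z) -> \int[mu]_z F z = 0.
Proof.
move=> mF Fodd; rewrite /Rintegral integralE.
set A := (\int[mu]_x _)%E; set B := (\int[mu]_x _)%E.
(* If both integrals are infinite, their difference is an infinite value, which is projected to the
   real number 0. *)
suff -> : A = B by case: B => [b| |] //=; rewrite subrr.
rewrite /A -ge0_integral_tuple_opp//; last first.
  by apply: measurable_funepos; exact/measurable_EFinP.
by apply: eq_integral => z _; rewrite funeposE funenegE /= Fodd EFinN.
Qed.

End gauss.

(** * First-order expansion of a Gaussian average *)

Section gauss_expansion.
Set Implicit Arguments.
Unset Strict Implicit.
Context {R : realType} {n : nat}.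
Local Notation mR := (measurableTypeR R).
Local Notation mu := (@lebesgue_measure_tuple R n).
Local Notation T := (n.-tuple mR).

Lemma sqnorm_le_expR (z : T) : sqnorm z <= 4 * expR (sqnorm z / 4).
Proof. by have := expR_ge1Dx (sqnorm z / 4); lra. Qed.

Lemma expR_sqnorm_ge1 (z : T) : 1 <= expR (sqnorm z / 4).
Proof. by rewrite -[leLHS]expR0 ler_expR divr_ge0// sqnorm_ge0. Qed.

(** Cauchy-Schwarz against the all-ones vector: both sides become double sums, compared termwise by
    the inequality between [a i * a j] and the mean of the two squares. *)
Lemma sqr_sum_le (a : 'I_n -> R) :
  (\sum_i a i) ^+ 2 <= n%:R * \sum_i a i ^+ 2.
Proof.
have -> : n%:R * \sum_i a i ^+ 2 =
    \sum_(i < n) \sum_(j < n) (a i ^+ 2 + a j ^+ 2) / 2.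
  under [RHS]eq_bigr do rewrite -mulr_suml big_split/= sumr_const card_ord.
  rewrite -mulr_suml big_split/= sumr_const card_ord sumrMnl mulr_natl.
  by rewrite -mulr2n -[X in X / _]mulr_natr mulfK ?pnatr_eq0.
rewrite expr2 mulr_suml; apply: ler_sum => i _.
rewrite mulr_sumr; apply: ler_sum => j _.
by have := sqr_ge0 (a i - a j); nra.
Qed.

(** Brings the quadratic Taylor remainder into the form that [gauss_dominated] accepts. *)
Lemma sqr_l1_le (a : 'I_n -> R) (z : T) :
  (\sum_i `|a i + tnth z i|) ^+ 2 <=
  (2 * n%:R * (\sum_i a i ^+ 2) + 8 * n%:R) * expR (sqnorm z / 4).
Proof.
have n0 : 0 <= n%:R :> R by [].
have A0 : 0 <= \sum_i a i ^+ 2 by apply: sumr_ge0 => i _; exact: sqr_ge0.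
apply: (@le_trans _ _ (n%:R * (2 * (\sum_i a i ^+ 2) + 2 * sqnorm z))).
  apply: le_trans (sqr_sum_le _) _; apply: ler_wpM2l => //.
  rewrite /sqnorm !mulr_sumr -big_split/=; apply: ler_sum => i _.
  by rewrite real_normK ?num_real//; have := sqr_ge0 (a i - tnth z i); nra.
have := sqnorm_le_expR z; have := expR_sqnorm_ge1 z.
move: (sqnorm z) (expR (sqnorm z / 4)) => q e e1 qe.
have : (\sum_i a i ^+ 2) <= (\sum_i a i ^+ 2) * e by rewrite ler_peMr.
move: (\sum_i a i ^+ 2) A0 => A A0 Ae.
have : A + q <= A * e + 4 * e by exact: lerD.
by move=> /(ler_wpM2l n0); nra.
Qed.

(** [F] splits into a constant, a part [L] linear in [z] and a remainder [G]. The constant is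
    integrated exactly, [L] is odd and contributes nothing, and [G] is dominated. *)
Lemma gauss_expansion (a b : 'I_n -> R) (y s M : R) (F : T -> R) :
  measurable_fun [set: T] F -> 0 <= M ->
  (forall z, `|F z - (y + s * \sum_i b i * (a i + tnth z i))| <=
    M * s ^+ 2 * (\sum_i `|a i + tnth z i|) ^+ 2) ->
  `|\int[mu]_z (F z * gauss 2^-1 z) -
    (y + s * \sum_i b i * a i) * \int[mu]_z gauss 2^-1 z| <=
  M * s ^+ 2 * (2 * n%:R * (\sum_i a i ^+ 2) + 8 * n%:R) *
    \int[mu]_z gauss 4^-1 z.
Proof.
move=> mF M0 FM.
have mlin (c : 'I_n -> R) :
    measurable_fun [set: T] (fun z => \sum_i b i * (c i + tnth z i)).
  apply: measurable_sum => i; apply: measurable_funM => //.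
  by apply: measurable_funD => //; exact: measurable_tnth_fun.
(* The summand 0 makes the sum an instance of [mlin]. *)
pose L (z : T) := s * \sum_i b i * (0 + tnth z i).
pose G z := F z - (y + s * \sum_i b i * (a i + tnth z i)).
have mL : measurable_fun [set: T] L by exact: measurable_funM.
have mG : measurable_fun [set: T] G.
  apply: measurable_funB => //; apply: measurable_funD => //.
  exact: measurable_funM.
have [z|iG leG] := @gauss_dominated _ _ G
  (M * s ^+ 2 * (2 * n%:R * (\sum_i a i ^+ 2) + 8 * n%:R)) mG.
  apply: le_trans (FM _) _; rewrite -[leRHS]mulrA; apply: ler_wpM2l.
    by rewrite mulr_ge0// sqr_ge0.
  exact: sqr_l1_le.
(* The factor 5 comes from [2 * |z_i| <= 1 + z_i ^+ 2], where 1 is at most the exponential and the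
   square at most 4 times it. *)
have [z|iL _] := @gauss_dominated _ _ L (`|s| * \sum_i `|b i| * 5) mL.
  rewrite normrM -mulrA ler_wpM2l// mulr_suml.
  apply: le_trans (ler_norm_sum _ _ _) _; apply: ler_sum => i _.
  rewrite normrM -mulrA add0r ler_wpM2l//.
  have : tnth z i ^+ 2 <= sqnorm z.
    by rewrite /sqnorm (bigD1 i)//= lerDl; apply: sumr_ge0 => j _; exact: sqr_ge0.
  have := sqnorm_le_expR z; have := expR_sqnorm_ge1 z.
  have : 0 <= (`|tnth z i| - 1) ^+ 2 by exact: sqr_ge0.
  have : `|tnth z i| ^+ 2 = tnth z i ^+ 2 by rewrite real_normK ?num_real.
  by nra.
have L0 : \int[mu]_z (L z * gauss 2^-1 z) = 0.
  apply: Rintegral_odd => [|z].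
    by apply: measurable_funM => //; exact: measurable_gauss.
  rewrite -mulNr; congr (_ * _).
    rewrite /L -mulrN -sumrN; congr (_ * _); apply: eq_bigr => i _.
    by rewrite tnth_mktuple !add0r mulrN.
  rewrite /gauss /sqnorm; congr (expR (- (_ * _))); apply: eq_bigr => i _.
  by rewrite tnth_mktuple sqrrN.
have i2 : mu.-integrable setT (EFin \o gauss 2^-1).
  by apply: integrable_gauss; rewrite invr_gt0.
have iY : mu.-integrable setT
    (EFin \o (fun z => (y + s * \sum_i b i * a i) * gauss 2^-1 z)).
  rewrite (_ : _ \o _ =
    fun z => ((y + s * \sum_i b i * a i)%:E * (gauss 2^-1 z)%:E)%E)//.
  exact: integrableZl.
rewrite (_ : \int[mu]_z (F z * gauss 2^-1 z) - _ =
  \int[mu]_z (G z * gauss 2^-1 z))//.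
apply/eqP; rewrite subr_eq; apply/eqP.
rewrite -RintegralZl//.
rewrite -[RHS]addr0 -[X in _ = _ + X]L0 -addrA -[X in _ = _ + X]RintegralD//.
rewrite -RintegralD//; last exact: (integrableD _ iY iL).
apply: eq_Rintegral => z _; rewrite -!mulrDl; congr (_ * _).
rewrite /G /L; under [in X in _ - X]eq_bigr do rewrite mulrDr.
under [in X in _ + (_ + X)]eq_bigr do rewrite add0r.
rewrite big_split/=; ring.
Qed.

End gauss_expansion.

(** * The path density as an average with a fixed Gaussian weight *)

Section path_density_substitution.
Set Implicit Arguments.
Unset Strict Implicit.
Context {R : realType} {d : nat}.
Local Notation mR := (measurableTypeR R).
Local Notation mu := (@lebesgue_measure_tuple R d).
Local Notation T := (d.-tuple mR).

Lemma measurable_row_affine (f : 'rV[R]_d -> R) (s : R) (v : 'rV[R]_d) :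
  measurable_fun [set: T] (f \o row_of_tuple) ->
  measurable_fun [set: T] (fun z : T => f (v + s *: row_of_tuple z)).
Proof.
move=> mf.
have mphi i : measurable_fun [set: mR] (fun x : mR => s * x + v ord0 i : mR).
  exact: measurable_affine.
have := measurableT_comp mf (measurable_tuple_comp mphi).
congr measurable_fun; apply/funext => z /=; congr f; apply/rowP => i.
by rewrite !mxE tnth_mktuple addrC.
Qed.

Lemma gaussian_density_scalar (m x : 'rV[R]_d) (e : R) : 0 < e ->
  gaussian_density m (e ^+ 2)%:M x =
  (Num.sqrt ((2 * pi) ^+ d * (e ^+ 2) ^+ d))^-1 *
  expR (- (2^-1 * \sum_i ((x - m) ord0 i / e) ^+ 2)).
Proof.
move=> e0; rewrite /gaussian_density det_scalar; congr (_ * expR _).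
rewrite invmx_scalar mul_mx_scalar /dotmul mulrC -mulrN; congr (_ * - _).
rewrite !mxE; apply: eq_bigr => i _; rewrite !mxE; field.
by rewrite gt_eqF.
Qed.

(** Since [k] is positive, an infinite integral of [g] stays infinite after scaling, and both real
    integrals are then 0. *)
Lemma Rintegral_scale d' (X : measurableType d') (m : {measure set X -> \bar R})
    (k : R) (f g : X -> R) : 0 < k ->
  (\int[m]_x (f x)%:E = k%:E * \int[m]_x (g x)%:E)%E ->
  \int[m]_x f x = k * \int[m]_x g x.
Proof.
move=> k0 fg; rewrite /Rintegral fg.
move: (\int[m]_x (g x)%:E)%E => [r| |]//=.
- by rewrite gt0_muley ?lte_fin//= mulr0.
- by rewrite gt0_muleNy ?lte_fin//= mulr0.
Qed.

(** The prefactor is the Jacobian of the substitution times the Gaussian normalisation. It does not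
    depend on [x], so it will cancel in the score. *)
Lemma path_densityE (q : 'rV[R]_d -> R) (e : R) (x : 'rV[R]_d) :
  0 < e -> e < 1 ->
  measurable_fun [set: T] (q \o row_of_tuple) -> (forall y, 0 <= q y) ->
  path_density q (1 - e) x =
  (e / (1 - e)) ^+ d * (Num.sqrt ((2 * pi) ^+ d * (e ^+ 2) ^+ d))^-1 *
  \int[mu]_z (q ((1 - e)^-1 *: x + (e / (1 - e)) *: row_of_tuple z) *
              gauss 2^-1 z).
Proof.
move=> e0 e1 mq q0.
have e'0 : 0 < 1 - e by rewrite subr_gt0.
have s0 : 0 < e / (1 - e) by rewrite divr_gt0.
have t1 : 1 - e != 1 by rewrite lt_eqF// ltrBlDr ltrDl.
rewrite /path_density (negbTE t1).
set N := (Num.sqrt _)^-1.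
have N0 : 0 < N.
  rewrite invr_gt0 sqrtr_gt0 mulr_gt0// exprn_gt0 ?exprn_gt0//.
  by rewrite mulr_gt0// pi_gt0.
pose F (u : T) := (q (row_of_tuple u) *
  gaussian_density ((1 - e) *: row_of_tuple u) ((1 - (1 - e)) ^+ 2)%:M x)%:E.
have FE u : F u = (q (row_of_tuple u) * (N *
    expR (- (2^-1 * \sum_i ((x ord0 i - (1 - e) * tnth u i) / e) ^+ 2))))%:E.
  rewrite /F subKr gaussian_density_scalar//; congr (_ * (_ * expR (- (_ * _))))%:E.
  by apply: eq_bigr => i _; rewrite !mxE.
have F0 u : (0 <= F u)%E.
  by rewrite FE lee_fin !mulr_ge0 ?expR_ge0// ltW.
have mF : measurable_fun [set: T] F.
  rewrite (funext FE); apply/measurable_EFinP; apply: measurable_funM => //.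
  apply: measurable_funM => //; apply: measurableT_comp => //.
  apply: measurableT_comp => //; apply: measurable_funM => //.
  apply: measurable_sum => i; apply: measurable_funX.
  apply: measurable_funM => //; apply: measurable_funB => //.
  by apply: measurable_funM => //; exact: measurable_tnth_fun.
(* After this substitution the quantity squared in the exponent, [(x_i - (1 - e) * u_i) / e], is
   just [- z_i]. *)
pose phi (i : 'I_d) (y : mR) : mR := e / (1 - e) * y + (1 - e)^-1 * x ord0 i.
have mphi i : measurable_fun [set: mR] (phi i) by exact: measurable_affine.
pose G (z : T) := q ((1 - e)^-1 *: x + (e / (1 - e)) *: row_of_tuple z) *
  gauss 2^-1 z.
have mG : measurable_fun [set: T] (EFin \o G).
  apply/measurable_EFinP; apply: measurable_funM; last exact: measurable_gauss.
  exact: measurable_row_affine.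
have Fphi z : F [tuple phi i (tnth z i) | i < d] = (N%:E * (G z)%:E)%E.
  rewrite FE -EFinM /G mulrCA; congr (_ * (q _ * expR (- (_ * _))))%:E.
    by apply/rowP => i; rewrite !mxE tnth_mktuple addrC.
  apply: eq_bigr => i _; rewrite tnth_mktuple /phi -[RHS]sqrrN; congr (_ ^+ 2).
  by field; rewrite !gt_eqF.
apply: Rintegral_scale; first by rewrite mulr_gt0// exprn_gt0.
have := @ge0_integral_tuple_comp _ d phi ((e / (1 - e))^-1) F _ mphi _ mF F0.
rewrite invr_ge0 ltW// => /(_ isT) intF.
have {}intF := intF (fun i f mf f0 => ge0_integral_affine _ s0 mf f0).
rewrite EFinM -muleA -ge0_integralZl//.
- under [in RHS]eq_integral do rewrite -Fphi.
  apply/esym; etransitivity; first exact: (congr1 (mule _) intF).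
  by rewrite muleA -EFinM -exprMn mulfV ?gt_eqF// expr1n mul1e.
- by move=> z _; rewrite lee_fin mulr_ge0// expR_ge0.
- by rewrite lee_fin ltW.
Qed.

End path_density_substitution.

(** * Directional derivatives as derivatives along a line *)

Section line_derivative.
Set Implicit Arguments.
Unset Strict Implicit.
Context {R : realType} {V : normedModType R}.
Implicit Types (f : V -> R) (x v : V).

Lemma is_derive_lineP f x v (t df : R) :
  is_derive (t *: v + x) v f df <-> is_derive t 1 (fun r => f (r *: v + x)) df.
Proof.
have E : (fun h : R => h^-1 *: ((f \o shift (t *: v + x)) (h *: v) -
                               f (t *: v + x))) =
    (fun h : R => h^-1 *: (((fun r => f (r *: v + x)) \o shift t) (h *: 1) -
                      f (t *: v + x))).
  by apply/funext => h /=; rewrite addrA -scalerDl [h *: 1]mulr1.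
by split => -[D1 D2]; constructor; move: D1 D2; rewrite /derivable /derive E.
Qed.

Lemma is_derive_line0P f x v (df : R) :
  is_derive x v f df <-> is_derive (0 : R) 1 (fun r => f (r *: v + x)) df.
Proof. by rewrite -is_derive_lineP scale0r add0r. Qed.

(** The mean value theorem along the segment, whose endpoints are ordered according to the sign of
    [h]. *)
Lemma line_lipschitz f x v (h B : R) : (forall y, derivable f y v) ->
  (forall t, `|t| <= `|h| -> `|'D_v f (t *: v + x)| <= B) ->
  `|f (h *: v + x) - f x| <= B * `|h|.
Proof.
move=> df fB.
have dg (t : R) : is_derive t 1 (fun r => f (r *: v + x)) ('D_v f (t *: v + x)).
  by apply/is_derive_lineP; exact: derivableP.
have cg : continuous (fun r : R => f (r *: v + x)).
  by move=> t; apply/differentiable_continuous/derivable1_diffP; have [] := dg t.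
have gB (a b : R) : a <= b -> (forall t, a <= t <= b -> `|t| <= `|h|) ->
    `|f (b *: v + x) - f (a *: v + x)| <= B * (b - a).
  move=> ab abh.
  have [|t tab ->] := MVT_segment ab (fun t _ => dg t).
    exact: continuous_subspaceT.
  rewrite normrM [`|b - a|]ger0_norm ?subr_ge0// ler_wpM2r ?subr_ge0//.
  by apply: fB; apply: abh; move: tab; rewrite in_itv.
have [h0|/ltW h0] := leP 0 h.
- have := gB _ _ h0; rewrite scale0r add0r subr0 ger0_norm//; apply => t.
  by move=> /andP[t0 th]; rewrite ger0_norm.
- have := gB _ _ h0; rewrite scale0r add0r sub0r distrC ler0_norm//; apply => t.
  by move=> /andP[th t0]; rewrite ler0_norm// lerN2.
Qed.

End line_derivative.

(** * Lipschitz and Taylor bounds from partial derivatives *)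

Section partial_derivatives.
Set Implicit Arguments.
Unset Strict Implicit.
Context {R : realType} {d : nat}.
Implicit Types (f : 'rV[R]_d -> R) (x h w : 'rV[R]_d) (i j k : 'I_d).

Local Notation e i := (delta_mx ord0 i : 'rV[R]_d).

(** The coordinates of [h] are switched on one at a time: [trunc m] keeps the first [m]. Each step
    moves along one axis, inside the box where the partials are bounded, and the increments
    telescope. *)
Lemma partial_lipschitz f x h (B : R) :
  (forall i y, derivable f y (e i)) ->
  (forall i w, (forall j, `|w ord0 j| <= `|h ord0 j|) ->
     `|partial i f (x + w)| <= B) ->
  `|f (x + h) - f x| <= B * \sum_j `|h ord0 j|.
Proof.
move=> df fB.
pose trunc m : 'rV[R]_d := \row_j (if (j < m)%N then h ord0 j else 0).
have trunc_le m j : `|trunc m ord0 j| <= `|h ord0 j|.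
  by rewrite mxE; case: ifP => // _; rewrite normr0.
have truncS k : trunc k.+1 = h ord0 k *: e k + trunc k.
  apply/rowP => j; rewrite !mxE ltnS leq_eqVlt eqxx/= val_eqE.
  by case: eqVneq => [->|_]; rewrite ?ltnn ?mulr1 ?mulr0 ?addr0 ?add0r.
suff H m : (m <= d)%N ->
    `|f (x + trunc m) - f x| <= B * \sum_(j < d | (j < m)%N) `|h ord0 j|.
  have := H d (leqnn d); rewrite (_ : trunc d = h); last first.
    by apply/rowP => j; rewrite mxE ltn_ord.
  by under eq_bigl do rewrite ltn_ord.
elim: m => [|m IH] md.
  rewrite big_pred0// mulr0 (_ : trunc 0%N = 0) ?addr0 ?subrr ?normr0//.
  by apply/rowP => j; rewrite !mxE.
pose k := Ordinal md.
rewrite (bigD1 k)//= (eq_bigl (fun j : 'I_d => (j < m)%N)); last first.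
  by move=> j; rewrite ltnS -val_eqE/= ltn_neqAle andbC.
have := truncS k; rewrite /= => ->.
rewrite mulrDr -(subrK (f (x + trunc m)) (f _)) -addrA.
apply: le_trans (ler_normD _ _) _; apply: lerD; last exact: IH (ltnW md).
rewrite addrCA; apply: line_lipschitz => // t th.
rewrite addrCA; apply: fB => j.
rewrite !mxE eqxx/=; case: eqVneq => [->|_];
  rewrite ?ltnn ?mulr1 ?mulr0 ?addr0 ?add0r//.
by case: ifP => // _; rewrite normr0.
Qed.

Lemma is_derive_linear (c : 'I_d -> R) x k :
  is_derive x (e k) (fun y : 'rV[R]_d => \sum_i y ord0 i * c i) (c k).
Proof.
apply/is_derive_line0P.
rewrite (_ : (fun r : R => _) = (fun r => r * c k + \sum_i x ord0 i * c i)).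
  by apply: is_derive_eq; rewrite addr0 scaler0 add0r /GRing.scale/= mulr1.
apply/funext => r; under eq_bigr do rewrite mxE mulrDl.
rewrite big_split/=; congr (_ + _); rewrite (bigD1 k)//= !mxE !eqxx/= mulr1.
rewrite big1 ?addr0// => i /negbTE ik.
by rewrite !mxE ik andbF mulr0 mul0r.
Qed.

(** [partial_lipschitz] is used twice: on the first partials of [f], to bound the partials of [f]
    minus its linear part at [x], and then on that difference itself. *)
Lemma taylor2 f x h (M : R) :
  (forall i y, derivable f y (e i)) ->
  (forall i j y, derivable (partial i f) y (e j)) ->
  (forall i j y, `|partial j (partial i f) y| <= M) ->
  `|f (x + h) - f x - \sum_i h ord0 i * partial i f x| <=
    M * (\sum_i `|h ord0 i|) ^+ 2.
Proof.
move=> df ddf fM.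
pose L (y : 'rV[R]_d) := \sum_i y ord0 i * partial i f x.
have dF k y : is_derive y (e k) (f - L) (partial k f y - partial k f x).
  apply: is_deriveB; first exact: derivableP.
  exact: is_derive_linear.
have := @partial_lipschitz (f - L) x h (M * \sum_i `|h ord0 i|).
rewrite -mulrA -expr2 (_ : (f - L) (x + h) - _ =
  f (x + h) - f x - \sum_i h ord0 i * partial i f x); last first.
  rewrite /L/= -![(_ - _) _]/(_ - _).
  under [X in _ - X - _]eq_bigr do rewrite mxE mulrDl.
  rewrite big_split/=; ring.
apply=> [i y|i w wh]; first by have [] := dF i y.
rewrite /partial derive_val -/(partial i f x).
apply: (@le_trans _ _ (M * \sum_j `|w ord0 j|)).
  by apply: partial_lipschitz.
have M0 : 0 <= M by apply: le_trans (fM i i x).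
by apply: ler_wpM2l => //; apply: ler_sum => j _; exact: wh.
Qed.

End partial_derivatives.

(** * Symmetry of mixed partials, and compact support *)

Section partial_derivatives2.
Set Implicit Arguments.
Unset Strict Implicit.
Context {R : realType} {d : nat}.
Implicit Types (f : 'rV[R]_d -> R) (x h w : 'rV[R]_d) (i j k : 'I_d).

Local Notation e i := (delta_mx ord0 i : 'rV[R]_d).

(** The second difference minus its leading term is the increment of a single function [F] along
    [e i], so the mean value bound applies. *)
Lemma second_difference f x i j (h M : R) :
  (forall i y, derivable f y (e i)) ->
  (forall i j y, derivable (partial i f) y (e j)) ->
  (forall w, `|partial i f (x + w) - partial i f x -
      \sum_k w ord0 k * partial k (partial i f) x| <=
    M * (\sum_k `|w ord0 k|) ^+ 2) ->
  `|f (x + h *: e i + h *: e j) - f (x + h *: e i) - f (x + h *: e j) + f x -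
    h ^+ 2 * partial j (partial i f) x| <= 5 * M * `|h| ^+ 3.
Proof.
move=> df ddf fM.
pose D := partial j (partial i f) x.
pose L (y : 'rV[R]_d) := \sum_k y ord0 k * (h * D).
pose F (y : 'rV[R]_d) := f (y + h *: e j) - f y - L y.
have dF y : is_derive y (e i) F
    (partial i f (y + h *: e j) - partial i f y - h * D).
  have d1 : is_derive y (e i) (fun y => f (y + h *: e j))
      (partial i f (y + h *: e j)).
    apply/is_derive_line0P.
    rewrite (_ : (fun _ => _) = (fun r => f (r *: e i + (y + h *: e j)))).
      by apply: (is_derive_line0P f (y + h *: e j) (e i) _).1; exact: derivableP.
    by apply/funext => r; rewrite addrA.
  have d2 : is_derive y (e i) f (partial i f y) by exact: derivableP.
  exact: is_deriveB (is_deriveB d1 d2) (is_derive_linear (fun _ => h * D) y i).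
have sum1 (t : R) k : \sum_l `|(t *: e k) ord0 l| = `|t|.
  rewrite (bigD1 k)//= big1 ?addr0 => [|l /negbTE lk].
    by rewrite !mxE !eqxx mulr1.
  by rewrite !mxE lk andbF mulr0 normr0.
have M0 : 0 <= M.
  have := le_trans (normr_ge0 _) (fM (1 *: e i)).
  by rewrite sum1 normr1 expr1n mulr1.
have sum2 (t : R) k (g : 'I_d -> R) : \sum_l (t *: e k) ord0 l * g l = t * g k.
  rewrite (bigD1 k)//= big1 ?addr0 => [|l /negbTE lk].
    by rewrite !mxE !eqxx mulr1.
  by rewrite !mxE lk andbF mulr0 mul0r.
have := @line_lipschitz _ _ F x (e i) h (5 * M * `|h| ^+ 2).
have -> : 5 * M * `|h| ^+ 3 = 5 * M * `|h| ^+ 2 * `|h| by ring.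
rewrite (_ : F (h *: e i + x) - F x =
  f (x + h *: e i + h *: e j) - f (x + h *: e i) - f (x + h *: e j) + f x -
  h ^+ 2 * D); last first.
  rewrite /F.
  have -> : L (h *: e i + x) = h * (h * D) + L x.
    rewrite /L -(sum2 h i (fun _ => h * D)) -big_split/=; apply: eq_bigr => k _.
    by rewrite mxE mulrDl.
  by rewrite [h *: e i + x]addrC; ring.
apply=> [y|t th]; first by have [] := dF y.
rewrite derive_val.
(* The derivative of [F] is a difference of two Taylor remainders of [partial i f] at [x], in which
   the terms in [t] cancel. The increments have l1 norm at most [2 * |h|] and [|h|], whence the
   constant 5 = 4 + 1. *)
have := fM (t *: e i + h *: e j); have := fM (t *: e i).
rewrite sum1 sum2 addrA [t *: e i + x]addrC.
have -> : \sum_k (t *: e i + h *: e j) ord0 k * partial k (partial i f) x =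
    t * partial i (partial i f) x + h * D.
  rewrite -(sum2 t i (fun k => partial k (partial i f) x)).
  rewrite -(sum2 h j (fun k => partial k (partial i f) x)) -big_split/=.
  by apply: eq_bigr => k _; rewrite mxE mulrDl.
set p1 := partial i f _; set p2 := partial i f _; set p3 := partial i f _.
set p4 := partial i (partial i f) x => H1 H2.
have {}H1 : `|p1 - p2 - t * p4| <= M * `|h| ^+ 2.
  apply: le_trans H1 _; apply: ler_wpM2l => //.
  by rewrite ler_sqr ?nnegrE.
have {}H2 : `|p3 - p2 - (t * p4 + h * D)| <= 4 * M * `|h| ^+ 2.
  apply: le_trans H2 _.
  have -> : 4 * M * `|h| ^+ 2 = M * (2 * `|h|) ^+ 2 by ring.
  apply: ler_wpM2l => //; rewrite ler_sqr ?nnegrE ?mulr_ge0 ?sumr_ge0//.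
  rewrite mulr_natl mulr2n -{2}(sum1 h j).
  apply: (@le_trans _ _ (\sum_l `|(t *: e i) ord0 l| +
    \sum_l `|(h *: e j) ord0 l|)).
    rewrite -big_split/=; apply: ler_sum => l _.
    by rewrite mxE; exact: ler_normD.
  by rewrite lerD2r sum1.
have -> : p3 - p1 - h * D =
  (p3 - p2 - (t * p4 + h * D)) - (p1 - p2 - t * p4) by ring.
apply: le_trans (ler_normB _ _) _.
by apply: le_trans (lerD H2 H1) _; rewrite -mulrDl; lra.
Qed.

(* Both mixed partials are the limit of the same symmetric second difference. *)
Lemma partialC f x i j (M : R) :
  (forall i y, derivable f y (e i)) ->
  (forall i j y, derivable (partial i f) y (e j)) ->
  (forall i w, `|partial i f (x + w) - partial i f x -
      \sum_k w ord0 k * partial k (partial i f) x| <=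
    M * (\sum_k `|w ord0 k|) ^+ 2) ->
  partial i (partial j f) x = partial j (partial i f) x.
Proof.
move=> df ddf fM.
set Dij := partial i _ x; set Dji := partial j _ x.
have H (h : R) : 0 < h -> `|Dij - Dji| <= 10 * M * h.
  move=> h0; have h20 : 0 < h ^+ 2 by rewrite exprn_gt0.
  have := second_difference j h df ddf (fM i).
  have := second_difference i h df ddf (fM j).
  rewrite -/Dij -/Dji [x + h *: e j + _]addrAC.
  rewrite [X in `|X + f x - _ * Dij| <= _ -> _]addrAC.
  set S := f _ - _ - _ + _ => H1 H2.
  have : `|h ^+ 2 * (Dij - Dji)| <= 10 * M * `|h| ^+ 3.
    have -> : h ^+ 2 * (Dij - Dji) = (S - h ^+ 2 * Dji) - (S - h ^+ 2 * Dij).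
      by ring.
    apply: le_trans (ler_normB _ _) _.
    have -> : 10 * M * `|h| ^+ 3 = 5 * M * `|h| ^+ 3 + 5 * M * `|h| ^+ 3 by ring.
    exact: lerD H2 H1.
  rewrite normrM (gtr0_norm h20) (gtr0_norm h0).
  rewrite (_ : 10 * M * h ^+ 3 = h ^+ 2 * (10 * M * h)).
    by rewrite ler_pM2l.
  by ring.
have M0 : 0 <= 10 * M.
  by have := le_trans (normr_ge0 _) (H _ ltr01); rewrite mulr1.
apply/eqP; rewrite -subr_eq0 -normr_eq0 eq_le normr_ge0 andbT.
apply/ler_addgt0Pr => eps eps0; rewrite add0r.
have c0 : 0 < 10 * M + 1 by rewrite ltr_wpDl.
apply: le_trans (H (eps / (10 * M + 1)) _) _; first by rewrite divr_gt0.
rewrite mulrA ler_pdivrMr// mulrC ler_pM2l//.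
by rewrite lerDl.
Qed.

Lemma compact_support_bounded f (K : set 'rV[R]_d) : compact K ->
  (forall x, ~ K x -> f x = 0) -> continuous f -> exists2 M : R,
    0 <= M & forall x, `|f x| <= M.
Proof.
move=> cK fK cf.
have /compact_bounded[M0 [_ fM]] : compact (f @` K).
  by apply: continuous_compact => //; exact: continuous_subspaceT.
exists (`|M0| + 1) => [|x]; first by rewrite addr_ge0.
have [Kx|nKx] := pselect (K x); last by rewrite fK// normr0 addr_ge0.
apply: fM; last by exists x.
by rewrite (le_lt_trans (ler_norm _))// ltrDl.
Qed.

(** The complement of [K] is open, so [f] vanishes on a neighbourhood of each of its points. *)
Lemma partial_eq0 f (K : set 'rV[R]_d) i : closed K ->
  (forall x, ~ K x -> f x = 0) -> forall x, ~ K x -> partial i f x = 0.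
Proof.
move=> clK fK x nKx; rewrite /partial -(derive_cst (0 : R) x (e i)).
apply: near_eq_derive.
have : nbhs x (~` K) by apply: open_nbhs_nbhs; split => //; exact: closed_openC.
by apply: filterS => y; exact: fK.
Qed.

End partial_derivatives2.

(** * Differentiation of Gaussian averages under the integral sign *)

Section gauss_smoothing.
Set Implicit Arguments.
Unset Strict Implicit.
Context {R : realType} {d : nat}.
Local Notation mR := (measurableTypeR R).
Local Notation mu := (@lebesgue_measure_tuple R d).
Local Notation T := (d.-tuple mR).
Local Notation e i := (delta_mx ord0 i : 'rV[R]_d).
Implicit Types (f : 'rV[R]_d -> R) (x : 'rV[R]_d) (i : 'I_d).

Lemma is_derive_quadratic (V : normedModType R) (f : V -> R) (x v : V)
    (df C : R) :
  (forall h, `|f (h *: v + x) - f x - h * df| <= C * h ^+ 2) ->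
  is_derive x v f df.
Proof.
move=> fC.
have C0 : 0 <= C.
  by have := le_trans (normr_ge0 _) (fC 1); rewrite expr1n mulr1.
suff H : (fun h : R => h^-1 *: ((f \o shift x) (h *: v) - f x)) @ 0^' --> df.
  by constructor; [apply/cvg_ex; exists df|exact: cvg_lim H].
apply/cvgrPdist_le => eps eps0; near=> h.
have h0 : h != 0 by near: h; exact: nbhs_dnbhs_neq.
rewrite distrC /= (_ : _ *: _ - df = (f (h *: v + x) - f x - h * df) / h).
  rewrite normrM normfV ler_pdivrMr ?normr_gt0//.
  apply: le_trans (fC h) _.
  rewrite -(real_normK (num_real h)) expr2 mulrA ler_wpM2r//.
  have : `|h| <= eps / (C + 1).
    near: h; apply: dnbhs0_le; rewrite divr_gt0// ltr_wpDl//.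
  rewrite ler_pdivlMr ?ltr_wpDl// => hC; apply: le_trans hC.
  by rewrite mulrC ler_wpM2l// lerDl.
by rewrite /GRing.scale/=; field.
Unshelve. all: by end_near. Qed.

Lemma taylor_dir f x i (h M : R) :
  (forall i y, derivable f y (e i)) ->
  (forall i j y, derivable (partial i f) y (e j)) ->
  (forall i j y, `|partial j (partial i f) y| <= M) ->
  `|f (x + h *: e i) - f x - h * partial i f x| <= M * h ^+ 2.
Proof.
move=> df ddf fM; have := taylor2 x (h *: e i) df ddf fM.
rewrite (bigD1 i)//= big1 => [|k /negbTE ki]; last first.
  by rewrite !mxE ki andbF mulr0 mul0r.
rewrite (bigD1 i)//= big1 => [|k /negbTE ki]; last first.
  by rewrite !mxE ki andbF mulr0 normr0.
by rewrite !mxE !eqxx mulr1 !addr0 real_normK ?num_real.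
Qed.

(** A partial derivative is the pointwise limit of the measurable difference quotients with step
    [1 / (m + 1)]. *)
Lemma measurable_partial f i (M : R) :
  (forall i y, derivable f y (e i)) ->
  (forall i j y, derivable (partial i f) y (e j)) ->
  (forall i j y, `|partial j (partial i f) y| <= M) ->
  measurable_fun [set: T] (f \o row_of_tuple) ->
  measurable_fun [set: T] (partial i f \o row_of_tuple).
Proof.
move=> df ddf fM mf.
pose g (m : nat) (u : T) := m.+1%:R *
  (f (m.+1%:R^-1 *: e i + 1 *: row_of_tuple u) - f (row_of_tuple u)).
apply: (@measurable_fun_cvg _ _ _ _ g) => [m|u _].
  apply: measurable_funM => //; apply: measurable_funB => //.
  exact: measurable_row_affine.
have M0 : 0 <= M by exact: le_trans (fM i i 0).
apply/cvgrPdist_le => eps eps0; near=> m.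
have m0 : m.+1%:R^-1 > 0 :> R by rewrite invr_gt0.
have := taylor_dir (row_of_tuple u) i m.+1%:R^-1 df ddf fM.
rewrite [row_of_tuple u + _]addrC; set y := row_of_tuple u; set D := f _ - _ => DM.
rewrite distrC /g scale1r -/y -/D.
have -> : m.+1%:R * D - partial i f y =
    (D - m.+1%:R^-1 * partial i f y) / m.+1%:R^-1.
  by rewrite invrK mulrBl [m.+1%:R * D]mulrC mulrAC mulVf ?mul1r // pnatr_eq0.
rewrite normrM [`|_^-1|]gtr0_norm ?invr_gt0// ler_pdivrMr//.
apply: le_trans DM _; rewrite expr2 mulrA ler_wpM2r ?(ltW m0)//.
have : m.+1%:R^-1 <= eps / (M + 1).
  near: m.
  have := near_infty_natSinv_lt (PosNum (divr_gt0 eps0 (ltr_wpDl M0 ltr01))).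
  by apply: filterS => m /ltW.
rewrite ler_pdivlMr ?ltr_wpDl// => hC; apply: le_trans hC.
by rewrite mulrC ler_wpM2l ?(ltW m0)// lerDl.
Unshelve. all: by end_near. Qed.

Definition gauss_smooth f (c s : R) x : R :=
  \int[mu]_z (f (c *: x + s *: row_of_tuple z) * gauss 2^-1 z).

Lemma integrable_bounded_gauss (F : T -> R) (M : R) :
  measurable_fun [set: T] F -> (forall z, `|F z| <= M) ->
  mu.-integrable setT (EFin \o (fun z => F z * gauss 2^-1 z)).
Proof.
move=> mF FM; have M0 : 0 <= M := le_trans (normr_ge0 _) (FM [tuple 0 | i < d]).
have [z|//] := @gauss_dominated _ _ F M mF.
by rewrite (le_trans (FM z))// ler_peMr// expR_sqnorm_ge1.
Qed.

(** The quadratic Taylor error is uniform in [z], so it can be integrated against the weight and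
    remains quadratic in [h]. Moving [x] by [h] moves the argument of [f] by [h * c], which yields
    the factor [c]. *)
Lemma is_derive_gauss_smooth f (c s M : R) x i :
  measurable_fun [set: T] (f \o row_of_tuple) ->
  (forall y, `|f y| <= M) -> (forall i y, `|partial i f y| <= M) ->
  (forall i y, derivable f y (e i)) ->
  (forall i j y, derivable (partial i f) y (e j)) ->
  (forall i j y, `|partial j (partial i f) y| <= M) ->
  is_derive x (e i) (gauss_smooth f c s) (c * gauss_smooth (partial i f) c s x).
Proof.
move=> mf fM dfM df ddf ddfM.
have mdf := measurable_partial i df ddf ddfM mf.
have M0 : 0 <= M by exact: le_trans (fM 0).
apply: (@is_derive_quadratic _ _ _ _ _ (M * c ^+ 2 * \int[mu]_z gauss 4^-1 z)).
move=> h; rewrite /gauss_smooth.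
have I1 y : mu.-integrable setT
    (EFin \o (fun z => f (c *: y + s *: row_of_tuple z) * gauss 2^-1 z)).
  by apply: (@integrable_bounded_gauss _ M) => //; exact: measurable_row_affine.
have I2 y : mu.-integrable setT (EFin \o
    (fun z => partial i f (c *: y + s *: row_of_tuple z) * gauss 2^-1 z)).
  by apply: (@integrable_bounded_gauss _ M) => //; exact: measurable_row_affine.
pose F (z : T) := f (c *: x + s *: row_of_tuple z + (h * c) *: e i) -
  f (c *: x + s *: row_of_tuple z) -
  (h * c) * partial i f (c *: x + s *: row_of_tuple z).
have FE z : F z = f (c *: (h *: e i + x) + s *: row_of_tuple z) -
  f (c *: x + s *: row_of_tuple z) -
  (h * c) * partial i f (c *: x + s *: row_of_tuple z).
  rewrite /F; congr (f _ - _ - _).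
  by rewrite scalerDr scalerA [c * h]mulrC [LHS]addrC addrA.
have FM z : `|F z| <= M * (h * c) ^+ 2 by exact: taylor_dir.
have mF : measurable_fun [set: T] F.
  rewrite (funext FE); apply: measurable_funB.
    by apply: measurable_funB; exact: measurable_row_affine.
  by apply: measurable_funM => //; exact: measurable_row_affine.
have [z|_ ] := @gauss_dominated _ _ F (M * (h * c) ^+ 2) mF.
  by rewrite (le_trans (FM z))// ler_peMr ?expR_sqnorm_ge1// mulr_ge0// sqr_ge0.
rewrite (_ : M * (h * c) ^+ 2 * _ =
  M * c ^+ 2 * (\int[mu]_z gauss 4^-1 z) * h ^+ 2); last by ring.
congr (`|_| <= _); rewrite mulrA -RintegralZl// -!RintegralB//.
- apply: eq_Rintegral => z _; rewrite FE; ring.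
- exact: (integrableB _ (I1 _) (I1 _)).
- rewrite (_ : _ \o _ = fun z => ((h * c)%:E *
    (partial i f (c *: x + s *: row_of_tuple z) * gauss 2^-1 z)%:E)%E)//.
  exact: (integrableZl _ (h * c) (I2 x)).
Qed.

End gauss_smoothing.

(** * Quotients of expansions, and the Euclidean norm *)

Section expansions.
Set Implicit Arguments.
Unset Strict Implicit.
Context {R : realType}.

(** Here [p] and [g] stand for the smoothed density and its smoothed partial. The choice of [delta]
    forces [p] to be at least [q / 2], which controls the denominator. *)
Lemma ratio_expansion (q D A B K : R) : 0 < q ->
  exists2 delta : R, 0 < delta & exists C : R, forall s p g : R,
    0 < s -> s < delta ->
    `|p - (q + s * B)| <= K * s ^+ 2 -> `|g - (D + s * A)| <= K * s ^+ 2 ->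
    0 < p /\
    `|(1 + s) * g / p - D / q - s * (D / q + A / q - D * B / q ^+ 2)| <=
      C * s ^+ 2.
Proof.
move=> q0; pose c := `|B| + `|K| + 1.
have c0 : 0 < c by rewrite ltr_wpDl// addr_ge0.
(* [E / q ^+ 2] is the coefficient of [s] in the quotient; the term [D * q] stems from the factor
   [1 + s]. *)
pose E := D * q + A * q - D * B.
pose C0 := `|A * q ^+ 2 - E * B| + 2 * `|K| * q ^+ 2 + `|D * q| * `|K| +
  `|E| * `|K|.
exists (Num.min 1 (q / (2 * c))) => [|].
  by rewrite lt_min ltr01 divr_gt0// mulr_gt0.
exists (C0 / (q ^+ 3 / 2)) => s p g s0.
rewrite lt_min ltr_pdivlMr ?mulr_gt0// => /andP[s1 sc] Hp Hg.
have K0 : K * s ^+ 2 <= `|K| * s ^+ 2 by rewrite ler_wpM2r ?sqr_ge0// ler_norm.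
have {Hp} := le_trans Hp K0; have {Hg} := le_trans Hg K0.
set t := g - _; set r := p - _ => tK rK.
have gE : g = D + s * A + t by rewrite /t; ring.
have pE : p = q + s * B + r by rewrite /r; ring.
have p2 : q / 2 <= p.
  have : `|s * B + r| <= s * (`|B| + `|K|).
    apply: le_trans (ler_normD _ _) _; rewrite normrM (gtr0_norm s0) mulrDr.
    rewrite lerD2l; apply: le_trans rK _.
    rewrite mulrC expr2 -mulrA ler_wpM2l ?(ltW s0)//.
    by rewrite ler_piMl// ltW.
  by rewrite ler_norml => /andP[+ _]; rewrite /c in sc; rewrite pE; nra.
have p0 : 0 < p by apply: lt_le_trans p2; rewrite divr_gt0.
split=> //.
set lhs := _ - _ - _.
(* Over the common denominator the terms of order 0 and 1 in [s] cancel. [C0] adds up the bounds of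
   the four terms left. *)
have -> : lhs = (s ^+ 2 * (A * q ^+ 2 - E * B) + (1 + s) * t * q ^+ 2 -
    D * q * r - s * E * r) / (p * q ^+ 2).
  have -> : lhs = ((1 + s) * g * q ^+ 2 - D * q * p - s * E * p) / (p * q ^+ 2).
    by rewrite /lhs /E; field; rewrite !gt_eqF.
  by congr (_ / _); rewrite gE pE /E; ring.
rewrite normrM normfV (gtr0_norm (_ : 0 < p * q ^+ 2)) ?mulr_gt0 ?exprn_gt0//.
rewrite ler_pdivrMr ?mulr_gt0 ?exprn_gt0//.
apply: (@le_trans _ _ (C0 * s ^+ 2)).
  have T1 : `|s ^+ 2 * (A * q ^+ 2 - E * B)| = `|A * q ^+ 2 - E * B| * s ^+ 2.
    by rewrite normrM mulrC (ger0_norm (sqr_ge0 s)).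
  have T2 : `|(1 + s) * t * q ^+ 2| <= 2 * `|K| * q ^+ 2 * s ^+ 2.
    rewrite normrM (ger0_norm (sqr_ge0 q)) normrM gtr0_norm ?addr_gt0//.
    have -> : 2 * `|K| * q ^+ 2 * s ^+ 2 = 2 * (`|K| * s ^+ 2) * q ^+ 2 by ring.
    rewrite ler_wpM2r ?sqr_ge0// ler_pM//; first by rewrite addr_ge0// ltW.
    by rewrite -[leRHS]/(1 + 1) lerD2l ltW.
  have T3 : `|D * q * r| <= `|D * q| * `|K| * s ^+ 2.
    by rewrite normrM -[leRHS]mulrA ler_wpM2l.
  have T4 : `|s * E * r| <= `|E| * `|K| * s ^+ 2.
    rewrite normrM -[leRHS]mulrA ler_pM// normrM (gtr0_norm s0).
    by rewrite ler_piMl// ltW.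
  have -> : C0 * s ^+ 2 = `|A * q ^+ 2 - E * B| * s ^+ 2 +
      2 * `|K| * q ^+ 2 * s ^+ 2 + `|D * q| * `|K| * s ^+ 2 +
      `|E| * `|K| * s ^+ 2 by rewrite /C0; ring.
  rewrite -T1.
  apply: le_trans (ler_normB _ _) _; apply: lerD => //.
  apply: le_trans (ler_normB _ _) _; apply: lerD => //.
  by apply: le_trans (ler_normD _ _) _; apply: lerD.
have q30 : 0 < q ^+ 3 / 2 by rewrite divr_gt0 ?exprn_gt0.
have C00 : 0 <= C0.
  by rewrite /C0; repeat (apply: sqr_ge0 || apply: normr_ge0 ||
    apply: addr_ge0 || apply: mulr_ge0).
have -> : C0 / (q ^+ 3 / 2) * s ^+ 2 * (p * q ^+ 2) =
    C0 * s ^+ 2 * (p / (q / 2)) by field; rewrite gt_eqF.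
apply: ler_peMr; first by rewrite mulr_ge0 ?sqr_ge0.
by rewrite ler_pdivlMr ?divr_gt0// mul1r.
Qed.

Section enorm.
Context {d : nat}.
Implicit Types u v : 'rV[R]_d.

Lemma dotmulE u v : dotmul u v = \sum_i u ord0 i * v ord0 i.
Proof. by rewrite /dotmul mxE; apply: eq_bigr => i _; rewrite mxE. Qed.

Lemma dotmul_ge0 u : 0 <= dotmul u u.
Proof. by rewrite dotmulE sumr_ge0// => i _; rewrite -expr2 sqr_ge0. Qed.

Lemma enorm_coord u i : `|u ord0 i| <= enorm u.
Proof.
rewrite -(ler_sqr (normr_ge0 _)) ?nnegrE ?sqrtr_ge0// sqr_sqrtr ?dotmul_ge0//.
rewrite real_normK ?num_real// dotmulE (bigD1 i)//= -expr2 lerDl.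
by rewrite sumr_ge0// => j _; rewrite -expr2 sqr_ge0.
Qed.

Lemma enormZ (k : R) u : enorm (k *: u) = `|k| * enorm u.
Proof.
rewrite /enorm -sqrtr_sqr -sqrtrM ?sqr_ge0//; congr Num.sqrt.
by rewrite !dotmulE mulr_sumr; apply: eq_bigr => i _; rewrite !mxE; ring.
Qed.

(* From |u|^2 - |v|^2 = <u - v, u + v>, which avoids Cauchy-Schwarz. *)
Lemma enorm_dist u v :
  `|enorm u - enorm v| <= \sum_i `|u ord0 i - v ord0 i|.
Proof.
have [nu nv] : 0 <= enorm u /\ 0 <= enorm v by rewrite !sqrtr_ge0.
(* The sum of the norms is about to be cancelled; when it is 0, both norms are 0. *)
have [uv0|uv0] := eqVneq (enorm u + enorm v) 0.
  have -> : enorm u - enorm v = 0 by lra.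
  by rewrite normr0 sumr_ge0.
have {}uv0 : 0 < enorm u + enorm v by rewrite lt_neqAle eq_sym uv0 addr_ge0.
rewrite -(ler_pM2r uv0) -{1}(gtr0_norm uv0) -normrM.
have -> : (enorm u - enorm v) * (enorm u + enorm v) =
    \sum_i (u ord0 i - v ord0 i) * (u ord0 i + v ord0 i).
  rewrite mulrDr !mulrBl [enorm v * _]mulrC addrA subrK -!expr2.
  rewrite !sqr_sqrtr ?dotmul_ge0// !dotmulE -sumrB.
  by apply: eq_bigr => i _; ring.
rewrite mulr_suml; apply: le_trans (ler_norm_sum _ _ _) _; apply: ler_sum => i _.
rewrite normrM ler_wpM2l//; apply: le_trans (ler_normD _ _) _.
by apply: lerD; exact: enorm_coord.
Qed.

End enorm.

End expansions.

(** * Derivatives of the logarithm of a positive function *)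

Section log_gradient.
Set Implicit Arguments.
Unset Strict Implicit.
Context {R : realType}.

Lemma is_derive_ln_comp (V : normedModType R) (f : V -> R) (x v : V) (df : R) :
  0 < f x -> is_derive x v f df -> is_derive x v (fun y => ln (f y)) (df / f x).
Proof.
move=> fx0 dfx; apply: (is_derive_line0P _ _ _ _).2.
have D1 : is_derive (0 : R) 1 (fun r => f (r *: v + x)) df.
  exact: (is_derive_line0P _ _ _ _).1.
rewrite mulrC.
apply: (@is_derive1_comp _ (@ln R) (fun r => f (r *: v + x))) => //.
by rewrite scale0r add0r; exact: is_derive1_ln.
Qed.

Lemma is_derive_quotient (V : normedModType R) (f g : V -> R) (x v : V)
    (df dg : R) : g x != 0 -> is_derive x v f df -> is_derive x v g dg ->
  is_derive x v (fun y => f y / g y) (df / g x - f x * dg / g x ^+ 2).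
Proof.
move=> gx0 Df [Dg1 Dg2].
have Dg : is_derive x v (fun y => (g y)^-1) (- (g x) ^- 2 *: dg).
  by constructor; [exact: derivableV|rewrite deriveV// Dg2].
apply: is_derive_eq (is_deriveM Df Dg) _.
by rewrite /GRing.scale/=; field.
Qed.

Context {d : nat}.
Implicit Types (q : 'rV[R]_d -> R) (x : 'rV[R]_d) (i j k : 'I_d).
Local Notation e i := (delta_mx ord0 i : 'rV[R]_d).

Lemma is_derive_coord x j k :
  is_derive x (e k) (fun y : 'rV[R]_d => y ord0 j) (k == j)%:R.
Proof.
have := @is_derive_linear R d (fun i => (i == j)%:R) x k.
congr (is_derive x (e k)); apply/funext => y.
rewrite (bigD1 j)//= eqxx mulr1 big1 ?addr0// => i /negbTE ->.
by rewrite mulr0.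
Qed.

Lemma partial_dot_log_gradient q a i : continuous q ->
  (forall i y, derivable q y (e i)) ->
  (forall i j y, derivable (partial i q) y (e j)) ->
  0 < q a ->
  partial i (fun x => dotmul x (gradient (fun y => ln (q y)) x)) a =
  partial i q a / q a + (\sum_j a ord0 j * partial i (partial j q) a) / q a -
    partial i q a * (\sum_j a ord0 j * partial j q a) / q a ^+ 2.
Proof.
move=> cq dq ddq qa0.
pose N x := \sum_j x ord0 j * partial j q x.
(* The formula for the gradient of [ln q] is established where [q] is positive, hence near [a] by
   continuity, and that suffices for a derivative at [a]. *)
rewrite /partial (@near_eq_derive _ _ _ _ (fun x => N x / q x)); last first.
  have qa_nbhs : nbhs (q a) [set r : R | 0 < r].
    by apply: open_nbhs_nbhs; split => //; exact: open_gt.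
  have qpos : \forall y \near a, 0 < q y := cq a _ qa_nbhs.
  near=> y; have qy0 : 0 < q y by near: y.
  rewrite dotmulE /N mulr_suml.
  apply: eq_bigr => j _; rewrite mxE -mulrA; congr (_ * _).
  have := is_derive_ln_comp qy0 (derivableP (dq j y)).
  by move=> D; exact: derive_val.
have DN : is_derive a (e i) N
    (partial i q a + \sum_j a ord0 j * partial i (partial j q) a).
  have Dj j : is_derive a (e i) (fun y => y ord0 j * partial j q y)
      (a ord0 j * partial i (partial j q) a + partial j q a * (i == j)%:R).
    exact: is_deriveM (is_derive_coord a j i) (derivableP (ddq j i a)).
  have := is_derive_sum Dj; rewrite fct_sumE => D.
  apply: is_derive_eq D _; rewrite big_split/= addrC; congr (_ + _).
  rewrite (bigD1 i)//= eqxx mulr1 big1 ?addr0// => j /negbTE ji.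
  by rewrite eq_sym ji mulr0.
have D := is_derive_quotient (lt0r_neq0 qa0) DN (derivableP (dq i a)).
rewrite (@derive_val _ _ _ _ _ _ _ D) mulrDl; congr (_ - _ / _).
by rewrite mulrC.
Unshelve. all: by end_near. Qed.

End log_gradient.

(** * Expansion of the score, by coordinates and then in norm *)

Section score_expansion.
Set Implicit Arguments.
Unset Strict Implicit.
Context {R : realType} {d : nat}.
Local Notation mR := (measurableTypeR R).
Local Notation mu := (@lebesgue_measure_tuple R d).
Local Notation T := (d.-tuple mR).
Local Notation e i := (delta_mx ord0 i : 'rV[R]_d).
Local Notation W := (\int[mu]_z gauss 2^-1 z).
Implicit Types (f q : 'rV[R]_d -> R) (a x : 'rV[R]_d) (i j k : 'I_d).

Lemma Ck_continuous n f : Ck n f -> continuous f.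
Proof. by case: n => [|n] // -[]. Qed.

Lemma family_bounded (I : finType) (f : I -> 'rV[R]_d -> R)
    (K : set 'rV[R]_d) : compact K ->
  (forall t x, ~ K x -> f t x = 0) -> (forall t, continuous (f t)) ->
  exists2 M : R, 0 <= M & forall t x, `|f t x| <= M.
Proof.
move=> cK fK cf.
have /choice[M HM] t : exists M : R, 0 <= M /\ forall x, `|f t x| <= M.
  by have [M] := compact_support_bounded cK (fK t) (cf t); exists M.
exists (\sum_t M t) => [|t x]; first by apply: sumr_ge0 => t _; case: (HM t).
apply: le_trans (_ : M t <= _); first by case: (HM t).
by rewrite (bigD1 t)//= lerDl sumr_ge0// => t' _; case: (HM t').
Qed.

(** As [(1 + s) *: a + s *: z] is [a + s *: (a + z)], Taylor at [a] with increment [s *: (a + z)]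
    supplies the hypothesis of [gauss_expansion]. *)
Lemma gauss_smooth_expansion f a (M : R) :
  measurable_fun [set: T] (f \o row_of_tuple) ->
  (forall i y, derivable f y (e i)) ->
  (forall i j y, derivable (partial i f) y (e j)) ->
  0 <= M -> (forall i j y, `|partial j (partial i f) y| <= M) ->
  exists K : R, forall s : R,
    `|gauss_smooth f (1 + s) s a / W -
      (f a + s * \sum_k a ord0 k * partial k f a)| <= K * s ^+ 2.
Proof.
move=> mf df ddf M0 fM.
have W0 : 0 < W by apply: Rintegral_gauss_gt0; rewrite invr_gt0.
exists (M * (2 * d%:R * (\sum_i a ord0 i ^+ 2) + 8 * d%:R) *
  (\int[mu]_z gauss 4^-1 z) / W) => s.
have H := @gauss_expansion R d (fun k => a ord0 k) (fun k => partial k f a)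
  (f a) s M (fun z : T => f ((1 + s) *: a + s *: row_of_tuple z)).
set y := f a + _.
rewrite (_ : _ / W - y = (gauss_smooth f (1 + s) s a - y * W) / W); last first.
  by field; rewrite gt_eqF.
rewrite normrM normfV (gtr0_norm W0) ler_pdivrMr// /y.
rewrite (_ : _ * s ^+ 2 * W = M * s ^+ 2 *
   (2 * d%:R * (\sum_i a ord0 i ^+ 2) + 8 * d%:R) *
    (\int[mu]_z gauss 4^-1 z)); last by field; rewrite gt_eqF.
under [X in (f a + s * X) * _]eq_bigr do rewrite mulrC.
apply: H => // [|z]; first exact: measurable_row_affine.
have := taylor2 a (s *: (a + row_of_tuple z)) df ddf fM.
rewrite scalerDr addrA (_ : a + s *: a = (1 + s) *: a); last first.
  by rewrite scalerDl scale1r.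
rewrite (_ : \sum_i _ * _ =
  s * \sum_i partial i f a * (a ord0 i + tnth z i)); last first.
  by rewrite mulr_sumr; apply: eq_bigr => i _; rewrite !mxE; ring.
rewrite (_ : \sum_i `|_| = `|s| * \sum_i `|a ord0 i + tnth z i|); last first.
  by rewrite mulr_sumr; apply: eq_bigr => i _; rewrite !mxE -mulrDr normrM.
by rewrite opprD addrA exprMn real_normK ?num_real// mulrA.
Qed.

Section smooth_compactly_supported.
Variables (q : 'rV[R]_d -> R) (K : set 'rV[R]_d) (a : 'rV[R]_d).
Hypothesis mq : measurable_fun [set: T] (q \o row_of_tuple).
Hypothesis q_ge0 : forall x, 0 <= q x.
Hypothesis cK : compact K.
Hypothesis qK : forall x, ~ K x -> q x = 0.
Hypothesis C3q : Ck 3 q.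
Hypothesis qa0 : 0 < q a.

Let clK : closed K.
Proof. by apply: compact_closed => //; exact: norm_hausdorff. Qed.

Lemma score1E i : score q 1 a ord0 i = partial i q a / q a.
Proof.
have [_ /(_ i)[dq _]] := C3q.
rewrite /score mxE /partial (_ : (fun x => _) = fun x => ln (q x)); last first.
  by apply/funext => x; rewrite /path_density eqxx.
have D := is_derive_ln_comp qa0 (derivableP (dq a)).
exact: derive_val.
Qed.

Lemma score_coord_expansion i : exists C : R, \forall eps \near 0^'+,
  `|(score q (1 - eps) a - score q 1 a) ord0 i -
    eps * gradient (fun x => dotmul x (gradient (fun y => ln (q y)) x)) a ord0 i|
  <= C * eps ^+ 2.
Proof.
have [cq C2] := C3q.
have dq j y : derivable q y (e j) by have [] := C2 j.
have C2q j : Ck 2 (partial j q) by have [] := C2 j.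
have ddq j k y : derivable (partial j q) y (e k).
  by have [_ /(_ k)[]] := C2q j.
have C1q j k : Ck 1 (partial k (partial j q)).
  by have [_ /(_ k)[]] := C2q j.
have dddq j k l y : derivable (partial k (partial j q)) y (e l).
  by have [_ /(_ l)[]] := C1q j k.
have C0q j k l : Ck 0 (partial l (partial k (partial j q))).
  by have [_ /(_ l)[]] := C1q j k.
(* Partials of every order up to 3 vanish outside [K] and are continuous, so they are globally
   bounded. *)
have K1 j := partial_eq0 j clK qK.
have K2 j k := partial_eq0 k clK (K1 j).
have K3 j k l := partial_eq0 l clK (K2 j k).
have [M0 M00 HM0] := compact_support_bounded cK qK cq.
have [M1 M10 HM1] := family_bounded cK K1 (fun j => Ck_continuous (C2q j)).
have [M2 M20 HM2] := @family_bounded ('I_d * 'I_d)%type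
  (fun t => partial t.2 (partial t.1 q)) K cK (fun t => K2 t.1 t.2)
  (fun t => Ck_continuous (C1q t.1 t.2)).
have [M3 M30 HM3] := @family_bounded ('I_d * 'I_d * 'I_d)%type
  (fun t => partial t.2 (partial t.1.2 (partial t.1.1 q))) K cK
  (fun t => K3 t.1.1 t.1.2 t.2) (fun t => Ck_continuous (C0q t.1.1 t.1.2 t.2)).
have mdq : measurable_fun [set: T] (partial i q \o row_of_tuple).
  by apply: (@measurable_partial _ _ q i M2) => // j k; exact: HM2 (j, k).
have [Kp HKp] := gauss_smooth_expansion a mq dq ddq M20 (fun j k => HM2 (j, k)).
have [Kg HKg] := gauss_smooth_expansion a mdq (ddq i) (dddq i) M30
  (fun j k => HM3 (i, j, k)).
(* Smoothing [partial i q] and differentiating the inner product produce the mixed partials in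
   opposite orders. *)
have clairaut j : partial j (partial i q) a = partial i (partial j q) a.
  apply: (@partialC _ _ q a j i M3) => // j' w.
  exact: taylor2 (ddq j') (dddq j') (fun k l => HM3 (j', k, l)).
have [del del0 [C HC]] := @ratio_expansion R (q a) (partial i q a)
  (\sum_k a ord0 k * partial k (partial i q) a)
  (\sum_k a ord0 k * partial k q a) (`|Kp| + `|Kg|) qa0.
set G := gradient _ a ord0 i.
have GE : G = partial i q a / q a +
    (\sum_k a ord0 k * partial k (partial i q) a) / q a -
    partial i q a * (\sum_k a ord0 k * partial k q a) / q a ^+ 2.
  have -> : \sum_k a ord0 k * partial k (partial i q) a =
      \sum_k a ord0 k * partial i (partial k q) a.
    by apply: eq_bigr => j _; rewrite clairaut.
  by rewrite /G mxE (partial_dot_log_gradient i cq dq ddq qa0).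
(* For [eps <= 1 / 2] one has [s <= 2 * eps]. The first term bounds [C * s ^+ 2]; the second bounds
   the cost [eps * s * G] of replacing [s] by [eps]. *)
exists (4 * `|C| + 2 * `|G|).
near=> eps.
have eps0 : 0 < eps by near: eps; exact: nbhs_right_gt.
have eps2 : eps <= 1 / 2.
  by near: eps; apply: nbhs_right_le; rewrite divr_gt0.
have epsdel : eps < del / 2.
  by near: eps; apply: nbhs_right_lt; rewrite divr_gt0.
have eps_lt1 : eps < 1 by lra.
have eps1 : 0 < 1 - eps by rewrite subr_gt0.
pose s := eps / (1 - eps).
have s0 : 0 < s by rewrite divr_gt0.
have sE : s = eps + eps * s by rewrite /s; field; rewrite gt_eqF.
have s2 : s <= 2 * eps by rewrite ler_pdivrMr//; nra.
have c1s : (1 - eps)^-1 = 1 + s by rewrite /s; field; rewrite gt_eqF.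
have W0 : 0 < W by apply: Rintegral_gauss_gt0; rewrite invr_gt0.
have Hp := HKp s; have Hg := HKg s.
set p := gauss_smooth q (1 + s) s a / W in Hp.
set g := gauss_smooth (partial i q) (1 + s) s a / W in Hg.
have s2_ge0 := sqr_ge0 s.
have [| | |p0 Hpg] := HC s p g s0 (le_lt_trans s2 _).
- by lra.
- apply: le_trans Hp _; apply: ler_wpM2r => //.
  by apply: le_trans (ler_norm _) _; rewrite lerDl.
- apply: le_trans Hg _; apply: ler_wpM2r => //.
  by apply: le_trans (ler_norm _) _; rewrite lerDr.
have scoreE : score q (1 - eps) a ord0 i = (1 + s) * g / p.
  (* This constant and the mass [W] in [p] and [g] both cancel in the logarithmic derivative. *)
  pose kappa := s ^+ d * (Num.sqrt ((2 * pi) ^+ d * (eps ^+ 2) ^+ d))^-1.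
  have kappa0 : 0 < kappa.
    rewrite mulr_gt0 ?exprn_gt0// invr_gt0 sqrtr_gt0 mulr_gt0 ?exprn_gt0//.
    by rewrite mulr_gt0 ?pi_gt0.
  have pathE : path_density q (1 - eps) = kappa *: gauss_smooth q (1 + s) s.
    by apply/funext => x; rewrite (path_densityE x eps0 eps_lt1 mq q_ge0) -/s c1s.
  have pa0 : 0 < gauss_smooth q (1 + s) s a.
    by move: p0; rewrite /p ltr_pdivlMr// mul0r.
  have Dgs : is_derive a (e i) (gauss_smooth q (1 + s) s)
      ((1 + s) * gauss_smooth (partial i q) (1 + s) s a).
    apply: (@is_derive_gauss_smooth _ _ q _ _ (M0 + M1 + M2)) => //.
    - by move=> y; apply: le_trans (HM0 y) _; rewrite -addrA lerDl addr_ge0.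
    - move=> j y; apply: le_trans (HM1 j y) _.
      by rewrite addrAC lerDr addr_ge0.
    - move=> j k y; apply: le_trans (HM2 (j, k) y) _.
      by rewrite lerDr addr_ge0.
  have pda0 : 0 < path_density q (1 - eps) a by rewrite pathE mulr_gt0.
  have Dpd : is_derive a (e i) (path_density q (1 - eps))
      (kappa *: ((1 + s) * gauss_smooth (partial i q) (1 + s) s a)).
    by rewrite pathE; exact: is_deriveZ.
  have D := is_derive_ln_comp pda0 Dpd.
  rewrite /score mxE /partial (@derive_val _ _ _ _ _ _ _ D) pathE /p /g.
  rewrite -![(_ *: _) _]/(_ * _) /GRing.scale/=.
  by field; rewrite !gt_eqF.
have -> : (score q (1 - eps) a - score q 1 a) ord0 i - eps * G =
    ((1 + s) * g / p - partial i q a / q a - s * G) + eps * s * G.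
  have -> : s * G = eps * G + eps * s * G by rewrite -mulrDl -sE.
  by rewrite mxE scoreE mxE score1E; ring.
apply: le_trans (ler_normD _ _) _; rewrite [leRHS]mulrDl; apply: lerD.
  rewrite GE; apply: le_trans Hpg _.
  apply: (@le_trans _ _ (`|C| * s ^+ 2)); first by rewrite ler_wpM2r ?ler_norm.
  have -> : 4 * `|C| * eps ^+ 2 = `|C| * (2 * eps) ^+ 2 by ring.
  have eps2_ge0 : 0 <= 2 * eps := le_trans (ltW s0) s2.
  by apply: ler_wpM2l => //; rewrite ler_sqr// nnegrE ltW.
have epss0 : 0 < eps * s := mulr_gt0 eps0 s0.
rewrite normrM (gtr0_norm epss0).
have -> : 2 * `|G| * eps ^+ 2 = eps * (2 * eps) * `|G| by ring.
by apply: ler_wpM2r => //; apply: ler_wpM2l => //; exact: ltW.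
Unshelve. all: by end_near. Qed.

Lemma score_expansion : exists2 C : R, 0 < C & \forall eps \near 0^'+,
  `|enorm (score q (1 - eps) a - score q 1 a) - eps * enorm (gradient
      (fun x => dotmul x (gradient (fun y => ln (q y)) x)) a)| <= C * eps ^+ 2.
Proof.
have /choice[C HC] := score_coord_expansion.
(* The coordinate errors add up by [enorm_dist]; the extra 1 makes the constant positive. *)
exists (\sum_i `|C i| + 1).
  by rewrite ltr_wpDl// sumr_ge0.
near=> eps.
have eps0 : 0 < eps by near: eps; exact: nbhs_right_gt.
rewrite -[X in _ - X * _](gtr0_norm eps0) -enormZ.
apply: le_trans (enorm_dist _ _) _.
apply: (@le_trans _ _ (\sum_i C i * eps ^+ 2)).
  apply: ler_sum => i _; rewrite [fun_of_matrix (eps *: _) _ _]mxE; move: i.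
  near: eps; exact: filter_forall.
rewrite -mulr_suml ler_wpM2r ?sqr_ge0//.
apply: (@le_trans _ _ (\sum_i `|C i|)); last by rewrite lerDl.
by apply: ler_sum => i _; exact: ler_norm.
Unshelve. all: by end_near. Qed.

End smooth_compactly_supported.
End score_expansion.

Theorem theorem3p2 (R : realType) (d : nat) (d_ge1 : (1 <= d)%N)
    (S : Type) (pibeta : S -> 'rV[R]_d -> R) (s : S)
    (pibeta_density : probability_density (pibeta s))
    (pibeta_support : exists2 K : set 'rV[R]_d,
       compact K & forall a, ~ K a -> pibeta s a = 0)
    (pibeta_C3 : Ck 3 (pibeta s))
    (a : 'rV[R]_d) (pibeta_a_gt0 : 0 < pibeta s a) :
  (fun eps : R => enorm (score (pibeta s) (1 - eps) a - score (pibeta s) 1 a))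
  = (fun eps : R => eps * enorm (gradient (fun x =>
       dotmul x (gradient (fun y => ln (pibeta s y)) x)) a))
    +O_ (0^'+) (fun eps : R => eps ^+ 2)
  /\
  (fun eps : R => enorm (score (pibeta s) (1 - eps) a - score (pibeta s) 1 a))
  =O_ (0^'+) (fun eps : R => eps).
Proof.
have [mq q0 _] := pibeta_density; have [K cK qK] := pibeta_support.
have [C C0 HC] := score_expansion mq q0 cK qK pibeta_C3 pibeta_a_gt0.
move: HC; set G := enorm (gradient _ _) => HC.
have G0 : 0 <= G by exact: sqrtr_ge0.
split.
  apply/eqaddOP/bigO_exP; exists C => //.
  near=> eps; rewrite [`|eps ^+ 2|]ger0_norm ?sqr_ge0//.
  by near: eps.
(* For [eps <= 1] the quadratic error is at most [C * eps], to which the leading term adds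
   [G * eps]. *)
apply/eqOP/bigO_exP; exists (G + C); first by rewrite ltr_wpDl.
near=> eps.
have eps0 : 0 < eps by near: eps; exact: nbhs_right_gt.
have eps1 : eps <= 1 by near: eps; exact: nbhs_right_le.
rewrite (gtr0_norm eps0) mulrDl.
have : `|enorm (score (pibeta s) (1 - eps) a - score (pibeta s) 1 a) - eps * G|
  <= C * eps ^+ 2 by near: eps.
set n := enorm _ => nG.
rewrite -(subrK (eps * G) n) addrC; apply: le_trans (ler_normD _ _) _.
apply: lerD; first by rewrite ger0_norm ?mulr_ge0 ?(ltW eps0)// mulrC.
apply: le_trans nG _; rewrite expr2 mulrA ler_piMr// mulr_ge0// ltW.
Unshelve. all: by end_near. Qed.
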